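(* For all integers $n,k,d\ge 1$, \[ \mathcal L^{S_n^{k-1}}_{\mathsf{TC}}(\textsc{Word}_{S_n,k})\ \ge\ n^{\log_2 k},\qquad \mathcal L^{S_n^{k-1}}_{\mathsf{TC}_d}(\textsc{Word}_{S_n,k})\ \ge\ n^{d(k^{1/d}-1)}. \]
   Context: Word problem. For a permutation group $G\le S_n$, let $\overline G$ be the set of $n\times n$ permutation matrices of elements of $G$. View $\overline G^k$ as a subset of $\{0,1\}^{kn^2}$, with Boolean variables $M_{i,a,b}$ ($i\in[k]$, $a,b\in[n]$) giving entry $(a,b)$ of the $i$-th matrix. $\textsc{Word}_{G,k}:\overline G^k\to\{0,1\}$ outputs the $(1,1)$-entry of the product $M_1M_2\cdots M_k$. The group $G^{k-1}$ acts on the variables by $(g_1,\dots,g_{k-1})\cdot M_{i,a,b}=M_{i,g_{i-1}(a),g_i(b)}$, where $g_0=g_k=1$; on matrix tuples this is $(M_1,\dots,M_k)\mapsto(M_1\overline{g_1}^{-1},\overline{g_1}M_2\overline{g_2}^{-1},\dots,\overline{g_{k-2}}M_{k-1}\overline{g_{k-1}}^{-1},\overline{g_{k-1}}M_k)$. Since the action is faithful, $G^{k-1}$ is viewed as a subgroup of $S_{kn^2}$. Formulas. An $m$-variable $\mathsf{TC}$ formula is a finite rooted tree, with the children of each node forming an unordered multiset. Each leaf is labeled by one of $0,1,x_1,\neg x_1,\dots,x_m,\neg x_m$, and each internal node (gate) is labeled $\textsc{maj}$ with unbounded fan-in; $\textsc{maj}$ outputs the majority of its inputs. An $\mathsf{AC}$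 formula is the same with gates labeled $\textsc{and}$ or $\textsc{or}$ (unbounded fan-in). Formulas are considered up to isomorphism of labeled rooted trees. The depth is the maximum number of gates on a leaf-to-root path. The size is the number of leaves labeled by literals. $S_m$ acts on formulas by relabeling $x_i\mapsto x_{\pi(i)}$ and $\neg x_i\mapsto\neg x_{\pi(i)}$. For $P\le S_m$, a formula $\Phi$ is $P$-invariant if $\pi\Phi=\Phi$ (as labeled trees) for all $\pi\in P$. A formula computes a partial function $f:\Omega\to\{0,1\}$ ($\Omega\subseteq\{0,1\}^m$) if it agrees with $f$ on $\Omega$. $\mathcal L^P_{\mathsf{TC}_d}(f)$ (resp. $\mathcal L^P_{\mathsf{TC}}(f)$) is the minimum size of a $P$-invariant $\mathsf{TC}$ formula of depth at most $d$ (resp. of any depth) computing $f$. $\mathcal L^P_{\mathsf{AC}_d}$ and $\mathcal L^P_{\mathsf{AC}}$ are defined analogously.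
   Formalization: The case n = 1 is excluded (n ≥ 2 is assumed): for n = 1 the word function is constantly 1, so the single leaf labeled 1 is an invariant formula of size 0, while both claimed bounds equal 1. *)

(* Defs.v *)
From mathcomp Require Import all_boot all_algebra all_fingroup.
From Stdlib Require Reals Lists.List Sorting.Permutation.

Set Implicit Arguments.
Unset Strict Implicit.
Unset Printing Implicit Defensive.

Import GRing.Theory.

(* Leaves: constants 0/1 and literals (TLit v true = x_v, TLit v false =
   not x_v); internal nodes: MAJ gates with a list of children.  The list
   order is irrelevant: formulas are compared up to isomorphism
   [tc_iso], i.e. up to permuting children at every gate. *)
Inductive tc (V : Type) : Type :=
| TConst of bool
| TLit of V & bool
| TMaj of seq (tc V).

Arguments TConst {V}.

Section TC.
Variable V : Type.

Fixpoint tc_eval (x : V -> bool) (f : tc V) : bool :=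
  match f with
  | TConst b => b
  | TLit v s => if s then x v else ~~ x v
  | TMaj cs =>
      let fix ones (l : seq (tc V)) : nat :=
        match l with [::] => 0 | c :: l' => (tc_eval x c : nat) + ones l' end in
      size cs < 2 * ones cs
  end.

Fixpoint tc_size (f : tc V) : nat :=
  match f with
  | TConst _ => 0
  | TLit _ _ => 1
  | TMaj cs =>
      let fix sz (l : seq (tc V)) : nat :=
        match l with [::] => 0 | c :: l' => tc_size c + sz l' end in
      sz cs
  end.

Fixpoint tc_depth (f : tc V) : nat :=
  match f with
  | TConst _ => 0
  | TLit _ _ => 0
  | TMaj cs =>
      let fix dp (l : seq (tc V)) : nat :=
        match l with [::] => 0 | c :: l' => maxn (tc_depth c) (dp l') end in
      (dp cs).+1
  end.

Fixpoint tc_wf (f : tc V) : bool :=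
  match f with
  | TConst _ => true
  | TLit _ _ => true
  | TMaj cs =>
      let fix wfl (l : seq (tc V)) : bool :=
        match l with [::] => true | c :: l' => tc_wf c && wfl l' end in
      (if cs is [::] then false else true) && wfl cs
  end.

Inductive tc_iso : tc V -> tc V -> Prop :=
| iso_const b : tc_iso (TConst b) (TConst b)
| iso_lit v s : tc_iso (TLit v s) (TLit v s)
| iso_maj (cs ds es : seq (tc V)) :
    Permutation.Permutation ds es ->
    List.Forall2 tc_iso cs es ->
    tc_iso (TMaj cs) (TMaj ds).

Definition tc_computes (Omega : (V -> bool) -> Prop) (f : (V -> bool) -> bool)
    (F : tc V) : Prop :=
  forall x, Omega x -> tc_eval x F = f x.
End TC.

Fixpoint tc_relabel (V : Type) (pi : V -> V) (f : tc V) : tc V :=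
  match f with
  | TConst b => TConst b
  | TLit v s => TLit (pi v) s
  | TMaj cs => TMaj (map (tc_relabel pi) cs)
  end.

Definition tc_invariant (V : finType) (P : {perm V} -> Prop) (F : tc V) : Prop :=
  forall pi, P pi -> tc_iso (tc_relabel pi F) F.

(* variable M_{i,a,b}, i in [k], a,b in [n] (0-indexed) *)
Definition wvar (n k : nat) : finType := ('I_k * 'I_n * 'I_n)%type.

Definition perm_tuples (n k : nat) (x : wvar n k -> bool) : Prop :=
  forall i : 'I_k, exists s : 'S_n, forall a b : 'I_n, x (i, a, b) = (s a == b).

Definition wmat (n k : nat) (x : wvar n k -> bool) (i : 'I_k) : 'M[int]_n :=
  \matrix_(a, b) (Posz (x (i, a, b) : nat)).

Definition wprod (n k : nat) (x : wvar n k -> bool) : 'M[int]_n :=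
  foldr (fun i A => (wmat x i *m A)%R) (1%:M)%R (enum 'I_k).

Definition Word (n k : nat) (x : wvar n k -> bool) : bool :=
  [exists a : 'I_n, exists b : 'I_n,
     [&& val a == 0, val b == 0 & wprod x a b == 1%R]].

(* The group S_n^{k-1}, as permutations of the variables:
   (g_1..g_{k-1}) . M_{i,a,b} = M_{i, g_{i-1}(a), g_i(b)}, g_0 = g_k = 1.
   (0-indexed: variable (i,a,b) with i < k is sent to (i, g_i a, g_{i+1} b).) *)
Definition SnPow (n k : nat) (pi : {perm wvar n k}) : Prop :=
  exists g : nat -> 'S_n,
    g 0 = 1%g /\ g k = 1%g /\
    forall (i : 'I_k) (a b : 'I_n), pi (i, a, b) = (i, g i a, g i.+1 b).

(* Main.v *)
(** Along a path from the root of the formula to a leaf, keep a group [U] of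
    symmetries of the current subformula and two words [sigma], [tau] that it
    separates.  Averaging over [U] shows that some child [c] of a MAJ gate has
    different means on the two [U]-orbits; hence, for every [eta] in [U], a
    translate of [c] separates [sigma] from the shift of [tau] by [eta], while
    the gate is at least [#|U : Stab c|] times as large as [c].

    If [n >= 5], let [U] be a power of the simple group [Alt_n], acting at the
    vertices interior to an interval of the word.  A subgroup of index less than
    [n ^ t.+1] contains all but at most [t] of the factors; these cut the
    interval into at most [t + 1] blocks, and [eta] can be chosen to move the
    difference of the words into the longest one.

    If [n <= 4], then [n] is a power of a prime [p], and [U] is a subgroup of a
    power of the cyclic group of order [n].  The invariant is that on every
    small set of positions [tau] can be carried to [sigma] by an element of
    order dividing [p] of [U]; passing to a subgroup whose elements of this
    kind have index [p ^ t] makes "small" stricter by the factor [t + 1].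

    In both cases the numbers [t] met along the path satisfy
    [k <= \prod (t + 1)] and [n ^ \sum t <= size], and it remains to minimize
    [\sum t] by convexity. *)

From Stdlib Require Import Reals Lra.
From Stdlib Require Lists.List Sorting.Permutation.
Require Import Defs.
From HB Require Import structures.
From mathcomp Require Import all_boot all_algebra all_fingroup all_solvable.
From mathcomp Require Import boolp zify.

Set Implicit Arguments.
Unset Strict Implicit.
Unset Printing Implicit Defensive.

(** * Formulas up to isomorphism *)

Section Formulas.
Variable V : Type.
Implicit Types (c d F : tc V) (cs ds es : seq (tc V)) (x : V -> bool).

Lemma tc_nested_ind (P : tc V -> Prop) :
  (forall b, P (TConst b)) -> (forall v s, P (TLit v s)) ->
  (forall cs, List.Forall P cs -> P (TMaj cs)) -> forall F, P F.
Proof.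
move=> Pc Pl Pm; fix IH 1 => -[b|v s|cs]; [exact: Pc | exact: Pl |].
by apply: Pm; elim: cs => [|c cs IHcs]; constructor.
Qed.

Definition ones x cs := sumn [seq (tc_eval x c : nat) | c <- cs].

Lemma tc_eval_maj x cs : tc_eval x (TMaj cs) = (size cs < 2 * ones x cs).
Proof. by rewrite /=; congr (_ < 2 * _); elim: cs => //= c cs ->. Qed.

Lemma tc_size_maj cs : tc_size (TMaj cs) = sumn (map (@tc_size V) cs).
Proof. by rewrite /=; elim: cs => //= c cs ->. Qed.

Lemma tc_depth_child cs c : List.In c cs -> tc_depth c < tc_depth (TMaj cs).
Proof.
rewrite /= ltnS; elim: cs => //= d cs IH [->|/IH h]; first exact: leq_maxl.
by rewrite (leq_trans h) ?leq_maxr.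
Qed.

Lemma tc_iso_maj_inv cs d : tc_iso (TMaj cs) d ->
  exists ds es, [/\ d = TMaj ds, Permutation.Permutation ds es &
                    List.Forall2 (@tc_iso V) cs es].
Proof. by move=> h; inversion h as [| |cs0 ds es p f]; exists ds, es. Qed.

Lemma tc_iso_lit_inv (v w : V) s : tc_iso (TLit v s) (TLit w s) -> v = w.
Proof. by move=> h; inversion h. Qed.

Lemma sumn_Permutation (A : Type) (f : A -> nat) (s t : seq A) :
  Permutation.Permutation s t -> sumn (map f s) = sumn (map f t).
Proof. by elim=> [|a s' t' _ /= ->|a b s'|s' t' u _ -> _ ->] //=; rewrite addnCA. Qed.

(** The assumption on [R] is confined to the members of [s], since an induction on formulas supplies
    it only for the children of the gate at hand. [Forall2_sym_in] and [Forall2_trans_in] are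
    relativized for the same reason. *)
Lemma sumn_Forall2 (A : Type) (f : A -> nat) (R : A -> A -> Prop) (s t : seq A) :
  List.Forall (fun a => forall b, R a b -> f a = f b) s ->
  List.Forall2 R s t -> sumn (map f s) = sumn (map f t).
Proof.
move=> fs Rst; elim: Rst fs => //= a b s' t' Rab _ IH fs.
by inversion fs as [|a0 s0 fa fs']; rewrite (fa b Rab) (IH fs').
Qed.

Lemma size_Forall2 (A B : Type) (R : A -> B -> Prop) (s : seq A) (t : seq B) :
  List.Forall2 R s t -> size s = size t.
Proof. by elim=> //= a b s' t' _ _ ->. Qed.

Lemma size_Permutation (A : Type) (s t : seq A) :
  Permutation.Permutation s t -> size s = size t.
Proof. by elim=> [|a s' t' _ /= ->|a b s'|s' t' u _ -> _ ->]. Qed.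

Lemma tc_iso_eval x c d : tc_iso c d -> tc_eval x c = tc_eval x d.
Proof.
elim/tc_nested_ind: c d => [b|v s|cs IH] d; try by move=> h; inversion h.
case/tc_iso_maj_inv=> ds [es [-> p f]]; rewrite !tc_eval_maj /ones.
rewrite (size_Forall2 f) (size_Permutation p); congr (_ < 2 * _).
rewrite (sumn_Permutation (fun c => tc_eval x c : nat) p).
apply: sumn_Forall2 f.
by apply: List.Forall_impl IH => c IHc d' /IHc ->.
Qed.

Lemma tc_iso_size c d : tc_iso c d -> tc_size c = tc_size d.
Proof.
elim/tc_nested_ind: c d => [b|v s|cs IH] d; try by move=> h; inversion h.
case/tc_iso_maj_inv=> ds [es [-> p f]]; rewrite !tc_size_maj.
by rewrite (sumn_Permutation (@tc_size V) p); apply: sumn_Forall2 IH f.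
Qed.

Lemma tc_iso_refl c : tc_iso c c.
Proof.
elim/tc_nested_ind: c => [b|v s|cs IH]; try by constructor.
apply: iso_maj (Permutation.Permutation_refl cs) _.
by elim: IH => [|c cs' hc _ IH]; constructor.
Qed.

Lemma Forall2_sym_in (A : Type) (R : A -> A -> Prop) (s t : seq A) :
  List.Forall (fun a => forall b, R a b -> R b a) s ->
  List.Forall2 R s t -> List.Forall2 R t s.
Proof.
move=> fs Rst; elim: Rst fs => //= a b s' t' Rab _ IH fs.
inversion fs as [|a0 s0 fa fs']; constructor; [exact: fa | exact: IH].
Qed.

Lemma Forall2_trans_in (A : Type) (R : A -> A -> Prop) (s t u : seq A) :
  List.Forall (fun a => forall b e, R a b -> R b e -> R a e) s ->
  List.Forall2 R s t -> List.Forall2 R t u -> List.Forall2 R s u.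
Proof.
move=> fs Rst; elim: Rst u fs => [|a b s' t' Rab _ IH] u fs h.
  by inversion h.
inversion h as [|b0 c t0 u' Rbc h']; inversion fs as [|a0 s0 fa fs'].
by constructor; [exact: fa Rab Rbc | exact: IH].
Qed.

Lemma tc_iso_sym c d : tc_iso c d -> tc_iso d c.
Proof.
elim/tc_nested_ind: c d => [b|v s|cs IH] d; try by move=> h; inversion h; constructor.
case/tc_iso_maj_inv=> ds [es [-> p f]].
have [cs' [pc fc]] := Permutation.Permutation_Forall2
  (Permutation.Permutation_sym p) (Forall2_sym_in IH f).
exact: iso_maj pc fc.
Qed.

Lemma tc_iso_trans c d F : tc_iso c d -> tc_iso d F -> tc_iso c F.
Proof.
elim/tc_nested_ind: c d F => [b|v s|cs IH] d F; try by move=> h; inversion h.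
case/tc_iso_maj_inv=> ds [es [-> p f]] /tc_iso_maj_inv[fs [gs [-> p' f']]].
have [gs' [pg fg]] := Permutation.Permutation_Forall2 p f'.
apply: iso_maj (Permutation.Permutation_trans p' pg) _.
exact: Forall2_trans_in IH f fg.
Qed.

Lemma tc_eval_relabel x (f : V -> V) c :
  tc_eval x (tc_relabel f c) = tc_eval (x \o f) c.
Proof.
elim/tc_nested_ind: c => // cs IH.
rewrite [tc_relabel _ _]/= !tc_eval_maj size_map /ones -map_comp.
congr (_ < 2 * _); elim: IH => //= c cs' -> _ /= IH.
by congr (_ + _); exact: IH.
Qed.

Lemma tc_size_relabel (f : V -> V) c : tc_size (tc_relabel f c) = tc_size c.
Proof.
elim/tc_nested_ind: c => // cs IH.
rewrite [tc_relabel _ _]/= !tc_size_maj -map_comp.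
by elim: IH => //= c cs' -> _ ->.
Qed.

Lemma tc_relabel_comp (f g : V -> V) c :
  tc_relabel f (tc_relabel g c) = tc_relabel (f \o g) c.
Proof.
elim/tc_nested_ind: c => //= cs IH; rewrite -map_comp; congr TMaj.
by elim: IH => //= c cs' -> _ ->.
Qed.

Lemma eq_tc_relabel (f g : V -> V) c : f =1 g -> tc_relabel f c = tc_relabel g c.
Proof.
move=> fg; elim/tc_nested_ind: c => //= [v s|cs IH]; first by rewrite fg.
by congr TMaj; elim: IH => //= c cs' -> _ ->.
Qed.

Lemma tc_relabel_id c : tc_relabel id c = c.
Proof.
elim/tc_nested_ind: c => //= cs IH; congr TMaj.
by elim: IH => //= c cs' -> _ ->.
Qed.

Lemma tc_iso_relabel (f : V -> V) c d :
  tc_iso c d -> tc_iso (tc_relabel f c) (tc_relabel f d).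
Proof.
elim/tc_nested_ind: c d => [b|v s|cs IH] d; try by move=> h; inversion h; constructor.
case/tc_iso_maj_inv=> ds [es [-> p h]] /=.
apply: iso_maj (Permutation.Permutation_map _ p) _.
elim: h IH => [|c e cs' es' ce _ IH1 IH]; first by constructor.
by inversion IH as [|c0 s0 hc hcs]; constructor; [exact: hc | exact: IH1].
Qed.

End Formulas.

(** * Orbit counting and averaging at an invariant majority gate *)

Section Step.
Variables (V : Type) (gT : finGroupType) (rho : gT -> V -> V).
Hypothesis rho1 : forall v, rho 1%g v = v.
Hypothesis rhoM : forall g h v, rho (g * h)%g v = rho g (rho h v).
Implicit Types (U : {group gT}) (x : V -> bool).

Definition fixed_by (A : {set gT}) (F : tc V) :=
  forall u, u \in A -> tc_iso (tc_relabel (rho u) F) F.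

Lemma fixed_by_eval (A : {set gT}) F x u : fixed_by A F -> u \in A ->
  tc_eval (x \o rho u) F = tc_eval x F.
Proof. by move=> invF /invF /(tc_iso_eval x) <-; rewrite tc_eval_relabel. Qed.

Lemma fixed_byS (A B : {set gT}) F :
  A \subset B -> fixed_by B F -> fixed_by A F.
Proof. by move=> /subsetP sAB invF u /sAB /invF. Qed.

Definition stab (A : {set gT}) (c : tc V) : {set gT} :=
  [set u in A | `[< tc_iso (tc_relabel (rho u) c) c >]].

Lemma stabP (A : {set gT}) c u :
  reflect (u \in A /\ tc_iso (tc_relabel (rho u) c) c) (u \in stab A c).
Proof.
by rewrite inE; apply: (iffP andP) => -[-> h]; split=> //; apply/asboolP.
Qed.

Lemma relabelM g h c :
  tc_relabel (rho (g * h)%g) c = tc_relabel (rho g) (tc_relabel (rho h) c).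
Proof. by rewrite tc_relabel_comp; apply: eq_tc_relabel => v; rewrite rhoM. Qed.

Lemma group_set_stab U c : group_set (stab U c).
Proof.
apply/group_setP; split.
  apply/stabP; split=> //.
  by rewrite (eq_tc_relabel c rho1) tc_relabel_id; exact: tc_iso_refl.
move=> g h /stabP[gU ig] /stabP[hU ih]; apply/stabP; split; first exact: groupM.
by rewrite relabelM; apply: tc_iso_trans ig; exact: tc_iso_relabel.
Qed.

Canonical stab_group U c := Group (group_set_stab U c).

Lemma stab_sub U c : stab U c \subset U.
Proof. by apply/subsetP => u /stabP[]. Qed.

Lemma fixed_by_stab U c : fixed_by (stab U c) c.
Proof. by move=> u /stabP[]. Qed.

Lemma Forall2_In (A B : Type) (R : A -> B -> Prop) s t a :
  List.Forall2 R s t -> List.In a s -> exists2 b, List.In b t & R a b.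
Proof.
elim=> //= a' b' s' t' Rab _ IH [<-|/IH[b hb Rb]]; first by exists b'; [left|].
by exists b => //; right.
Qed.

Lemma ones_fixed_by U cs x u : fixed_by U (TMaj cs) -> u \in U ->
  ones (x \o rho u) cs = ones x cs.
Proof.
move=> invF /invF /= /tc_iso_maj_inv[ds [es [[<-] p f]]].
rewrite /ones (sumn_Permutation (fun c => tc_eval x c : nat) p).
have /(_ _ f) <- := @sumn_Forall2 _ (fun c => tc_eval x c : nat) (@tc_iso V)
  (map (tc_relabel (rho u)) cs) es.
  by rewrite -map_comp; congr sumn; apply: eq_map => c /=; rewrite tc_eval_relabel.
by apply/List.Forall_forall => c _ d /tc_iso_eval ->.
Qed.

(* Distinct cosets of the stabilizer move [c] to non-isomorphic subformulas,
   each of which is again a child of the invariant gate. *)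
Lemma orbit_size U cs c : fixed_by U (TMaj cs) -> List.In c cs ->
  #|U : stab U c|%g * tc_size c <= tc_size (TMaj cs).
Proof.
move=> invF c_cs.
have ex u : u \in U ->
    exists j : 'I_(size cs), tc_iso (tc_relabel (rho u) c) (nth c cs j).
  move=> /invF /= /tc_iso_maj_inv[ds [es [[<-] p f]]].
  have [e /(Permutation.Permutation_in _ (Permutation.Permutation_sym p)) e_cs ie] :=
    Forall2_In f (List.in_map (tc_relabel (rho u)) _ _ c_cs).
  have [j [/ltP lt_j nth_j]] := List.In_nth cs e c e_cs.
  exists (Ordinal (lt_j : j < size cs)); suff -> : nth c cs j = e by [].
  by rewrite -nth_j; elim: (cs) (j) => [|? ? IH] [|?] //=.
have [j0 _] := ex 1%g (group1 U).
pose idx u := odflt j0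
  [pick j : 'I_(size cs) | `[< tc_iso (tc_relabel (rho u) c) (nth c cs j) >]].
have idxP u : u \in U -> tc_iso (tc_relabel (rho u) c) (nth c cs (idx u)).
  move=> /ex[j hj]; rewrite /idx; case: pickP => [i /asboolP//|/(_ j)].
  by move/asboolP: hj => ->.
have idx_size j : j \in idx @: U -> tc_size (nth c cs j) = tc_size c.
  by case/imsetP=> u /idxP/tc_iso_size eq_sz ->; rewrite -eq_sz tc_size_relabel.
(* If [u] and [v] get the same index then [u^-1 * v] stabilizes [c], so each fiber of [idx] lies in
   one left coset of the stabilizer. *)
have fib : #|U : stab U c|%g <= #|idx @: U|.
  rewrite -(leq_pmul2l (cardG_gt0 [group of stab U c])) /= Lagrange ?stab_sub //.
  rewrite -sum1_card (partition_big_imset idx) /= mulnC -sum_nat_const.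
  apply: leq_sum => j /imsetP[u uU ->].
  rewrite sum1dep_card -(card_lcoset (stab U c) u); apply/subset_leq_card/subsetP => v.
  rewrite inE => /andP[vU /eqP eq_idx]; rewrite mem_lcoset; apply/stabP.
  split; first by rewrite groupM ?groupV.
  rewrite relabelM; apply: tc_iso_trans (tc_iso_relabel _ (idxP v vU)) _.
  rewrite eq_idx; apply: tc_iso_trans (tc_iso_relabel _ (tc_iso_sym (idxP u uU))) _.
  rewrite -relabelM mulVg (eq_tc_relabel c rho1) tc_relabel_id.
  exact: tc_iso_refl.
rewrite tc_size_maj sumnE big_map (big_nth c) big_mkord.
rewrite (bigID (mem (idx @: U))) /=; apply: leq_trans (leq_addr _ _).
rewrite (eq_bigr (fun=> tc_size c)) => [|j /idx_size//].
by rewrite sum_nat_const leq_mul2r fib orbT.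
Qed.

(* Averaging over [U]: some child has different means on the [U]-orbits of
   [a] and [b], so no shift [eta] can match the two orbits. *)
Lemma sensitive_child U cs (a b : V -> bool) :
  fixed_by U (TMaj cs) -> tc_eval a (TMaj cs) != tc_eval b (TMaj cs) ->
  exists2 c, List.In c cs &
    forall eta, eta \in U -> exists2 u, u \in U &
      tc_eval (a \o rho u) c != tc_eval (b \o rho (eta * u)%g) c.
Proof.
move=> invF; apply: contra_neqP => noc.
have mean c : List.In c cs ->
    \sum_(u in U) tc_eval (a \o rho u) c = \sum_(u in U) tc_eval (b \o rho u) c.
  move=> c_cs; apply: contrapT => neq; apply: noc; exists c => // eta etaU.
  apply: contrapT => h; apply: neq.
  (* Left translation by [eta] permutes [U], so the sum over the orbit of [b] is unchanged by the
     shift. *)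
  rewrite [RHS](reindex_inj (mulgI eta)) /=; apply: eq_big => u.
    by rewrite groupMl.
  move=> uU; congr nat_of_bool; apply/eqP; apply: contraT => ne.
  by case: h; exists u.
(* By invariance the number of true children is constant on a [U]-orbit of inputs, so it equals its
   own average and splits child by child. *)
have avg x : #|U| * ones x cs = \sum_(c <- cs) \sum_(u in U) tc_eval (x \o rho u) c.
  rewrite exchange_big /= -sum_nat_const; apply: eq_bigr => u uU.
  by rewrite -(ones_fixed_by _ invF uU) /ones sumnE big_map.
have eq_ab : ones a cs = ones b cs.
  apply/eqP; rewrite -(eqn_pmul2l (cardG_gt0 U)) !avg; apply/eqP.
  elim: (cs) mean => [|c cs' IH] h; rewrite ?big_nil // !big_cons h ?IH //=.
    by move=> d hd; apply: h; right.
  by left.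
by rewrite !tc_eval_maj eq_ab.
Qed.

End Step.

(** * Words and their gauge group *)

Section Words.
Variables n k : nat.
Local Open Scope group_scope.

(** Letter [i] of a word is the edge from vertex [i] to vertex [i.+1], and a gauge has one value at
    each of the [k.+1] vertices. The two end vertices are kept for uniform indexing; the group of
    the theorem is recovered by support in [itv 0 k]. *)
Definition gauge := {dffun forall _ : 'I_k.+1, 'S_n}.
HB.instance Definition _ := FinGroup.on gauge.

Implicit Types (K L : {set 'I_k.+1}) (g h : gauge) (A B : {group 'S_n}).
Implicit Types (sigma tau : nat -> 'S_n).

(* Mathcomp composes permutations left to right, so that inverses are needed
   to make [rho] a left action on the variables; on words it becomes the right
   action [wact]. *)
Definition rho g (v : wvar n k) : wvar n k :=
  (v.1.1, (g (inord v.1.1))^-1 v.1.2, (g (inord v.1.1.+1))^-1 v.2).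

Definition wact sigma g : nat -> 'S_n :=
  fun i => (g (inord i))^-1 * sigma i * g (inord i.+1).

Definition word_input sigma : wvar n k -> bool := fun v => sigma v.1.1 v.1.2 == v.2.

Lemma gaugeM g h j : (g * h) j = g j * h j.
Proof. by rewrite ffunE. Qed.

Lemma gaugeV g j : g^-1 j = (g j)^-1.
Proof. by rewrite ffunE. Qed.

Lemma gauge1 j : (1 : gauge) j = 1.
Proof. by rewrite ffunE. Qed.

Lemma rho1 v : rho 1 v = v.
Proof. by case: v => [[i a] b]; rewrite /rho /= !gauge1 invg1 !perm1. Qed.

Lemma rhoM g h v : rho (g * h) v = rho g (rho h v).
Proof. by rewrite /rho /= !gaugeM !invMg !permM. Qed.

Lemma word_input_rho sigma g : word_input sigma \o rho g = word_input (wact sigma g).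
Proof.
apply/funext => -[[i a] b]; rewrite /word_input /rho /wact /= !permM.
by rewrite -(inj_eq (@perm_inj _ (g (inord i.+1)))) permKV.
Qed.

Lemma eq_word_input sigma tau :
  (forall i, i < k -> sigma i = tau i) -> word_input sigma = word_input tau.
Proof. by move=> eq_st; apply/funext => -[[i a] b]; rewrite /word_input eq_st. Qed.

Lemma wactM sigma g h i : wact sigma (g * h) i = wact (wact sigma g) h i.
Proof. by rewrite /wact !gaugeM invMg !mulgA. Qed.

Definition gpow A (K : {set 'I_k.+1}) : {set gauge} :=
  setXn (fun j => if j \in K then A else [1 'S_n])%G.
Canonical gpow_group A K := [group of gpow A K].

Lemma gpowP A K g :
  reflect (forall j, g j \in if j \in K then A : {set _} else 1) (g \in gpow A K).
Proof.
apply: (iffP setXnP) => h j; have := h j; case: ifP => //.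
Qed.

Lemma gpow_mem A K g j : g \in gpow A K -> g j \in A.
Proof. by move/gpowP/(_ j); case: ifP => // _ /set1P ->. Qed.

Lemma gpow_out A K g j : g \in gpow A K -> j \notin K -> g j = 1.
Proof. by move/gpowP/(_ j); case: ifP => // _ /set1P. Qed.

Lemma gpowS A B K L : A \subset B -> K \subset L -> gpow A K \subset gpow B L.
Proof.
move=> /subsetP sAB /subsetP sKL; apply/subsetP => g /gpowP gA; apply/gpowP => j.
have := gA j; case: ifP => [/sKL -> /sAB //|_ /set1P ->].
by case: ifP; rewrite group1.
Qed.

Lemma card_gpow A K : #|gpow A K| = (#|A| ^ #|K|)%N.
Proof.
rewrite /gpow cardsXn (bigID (mem K)) /= [X in (_ * X)%N]big1 ?muln1.
  by rewrite (eq_bigr (fun=> #|A|)) ?prod_nat_const // => j ->.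
by move=> j /negPf ->; rewrite cards1.
Qed.

(** With both end vertices excluded, a gauge supported here alters only letters [i] with
    [s <= i < t] and, when [s < t <= k], preserves their product. *)
Definition itv (s t : nat) : {set 'I_k.+1} := [set j : 'I_k.+1 | s < j < t].

Lemma wact_mem A sigma g : (forall i, i < k -> sigma i \in A) ->
  g \in gpow A setT -> forall i, i < k -> wact sigma g i \in A.
Proof.
by move=> sA gA i ik; rewrite !groupM ?groupV ?sA //; apply: gpow_mem gA.
Qed.

Definition wprefix sigma j := \prod_(0 <= i < j) sigma i.

Lemma wprefixS sigma j : wprefix sigma j.+1 = wprefix sigma j * sigma j.
Proof. by rewrite /wprefix big_nat_recr. Qed.

(* The gauge [eta] carries [tau] to [sigma] along the prefix before [p] and
   along the suffix after [p]. *)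
Lemma gauge_to_single_difference A sigma tau s t p :
  s <= p < t -> t <= k ->
  (forall i, i < k -> sigma i \in A) -> (forall i, i < k -> tau i \in A) ->
  (forall i, i < k -> ~~ (s <= i < t) -> sigma i = tau i) ->
  exists2 eta, eta \in gpow A (itv s t) &
    forall i, i < k -> i != p -> wact tau eta i = sigma i.
Proof.
move=> /andP[sp pt] tk sA tA eq_st.
(* For constant [z] the gauge [e] carries [tau] to [sigma] at every letter. The value 1 makes [e]
   trivial up to vertex [s], the other value makes it trivial from [t] on, and the switch between
   them affects letter [p] alone. *)
pose z j := if j <= p then 1 else wprefix tau k * (wprefix sigma k)^-1.
pose e j := (wprefix tau j)^-1 * z j * wprefix sigma j.
have prefA w j : (forall i, i < k -> w i \in A) -> j <= k -> wprefix w j \in A.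
  move=> wA jk; rewrite /wprefix big_nat; apply: group_prod => i /andP[_ ij].
  by apply: wA; exact: leq_trans jk.
have eA j : j <= k -> e j \in A.
  move=> jk; rewrite /e /z; case: ifP => _;
    by rewrite !(groupM, groupV, group1, prefA).
have e_lo j : j <= s -> e j = 1.
  move=> js; rewrite /e /z (leq_trans js sp) mulg1.
  suff -> : wprefix sigma j = wprefix tau j by rewrite mulVg.
  apply: eq_big_nat => i /andP[_ ij].
  by apply: eq_st; lia.
have e_hi j : t <= j -> j <= k -> e j = 1.
  move=> tj jk; rewrite /e /z leqNgt (leq_trans pt tj) /=.
  have cat w : wprefix w k = wprefix w j * \prod_(j <= i < k) w i.
    by rewrite /wprefix (big_cat_nat (n := j)).
  have eq_suf : \prod_(j <= i < k) tau i = \prod_(j <= i < k) sigma i.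
    by apply: eq_big_nat => i /andP[ji ik]; apply/esym/eq_st; lia.
  by rewrite !cat eq_suf invMg !mulgA mulVg mul1g mulgV mul1g mulVg.
exists [ffun j : 'I_k.+1 => e j].
  apply/gpowP => j; rewrite ffunE inE; case: ifPn => [_|].
    by apply: eA; rewrite -ltnS.
  rewrite negb_and -!leqNgt => /orP[/e_lo ->|/e_hi ->]; rewrite ?group1 //.
  by rewrite -ltnS.
move=> i ik ip; rewrite /wact !ffunE !inordK ?ltnS ?(ltnW ik) // /e !wprefixS.
have -> : z i.+1 = z i by rewrite /z ltn_neqAle ip.
by rewrite !invMg !invgK !mulgA !mulgK mulgKV mulVg mul1g.
Qed.

Lemma rho_inj g : injective (rho g).
Proof. by apply: (can_inj (g := rho g^-1)) => v; rewrite -rhoM mulVg rho1. Qed.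

Lemma tc_invariant_gauge F A : tc_invariant (@SnPow n k) F ->
  fixed_by rho (gpow A (itv 0 k)) F.
Proof.
move=> invF u uK.
rewrite (eq_tc_relabel (g := perm (@rho_inj u))); last by move=> v; rewrite permE.
apply: invF; exists (fun j => (u (inord j))^-1); split; last split.
- by rewrite (gpow_out uK) ?invg1 // inE inordK.
- by rewrite (gpow_out uK) ?invg1 // inE inordK // ltnn andbF.
by move=> i a b; rewrite permE.
Qed.

Lemma perm_tuples_word_input sigma : perm_tuples (word_input sigma).
Proof. by move=> i; exists (sigma i). Qed.

Lemma Word_word_input sigma (o : 'I_n) : val o = 0%N ->
  Word (word_input sigma) = (wprefix sigma k o == o).
Proof.
move=> o0; have prodE : wprod (word_input sigma) = perm_mx (wprefix sigma k).
  rewrite /wprod /wprefix big_mkord.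
  have -> : enum 'I_k = index_enum _ by rewrite enumT [index_enum _]unlock.
  elim: (index_enum _) => [|i s IH] /=; first by rewrite big_nil perm_mx1.
  rewrite big_cons perm_mxM -IH; congr (_ *m _)%R; apply/matrixP => a b.
  by rewrite !mxE /word_input /=; case: eqP.
rewrite /Word prodE; apply/existsP/eqP => [[a /existsP[b /and3P[/eqP a0 /eqP b0]]]|e].
  have -> : a = o by apply: val_inj; rewrite /= o0.
  have -> : b = o by apply: val_inj; rewrite /= o0.
  by rewrite !mxE; case: (_ =P o).
by exists o; apply/existsP; exists o; rewrite !o0 !eqxx !mxE e eqxx.
Qed.

(** The trivial word and the word with single nontrivial letter [w] have products that fix and move
    [o]. Both have letters in [A], so the later arguments may work inside any subgroup that moves
    [o]. *)
Lemma computing_formula_distinguishes F A (w : 'S_n) (o : 'I_n) :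
  0 < k -> val o = 0%N -> w \in A -> w o != o ->
  tc_computes (@perm_tuples n k) (@Word n k) F ->
  exists sigma tau, [/\ forall i, sigma i \in A, forall i, tau i \in A &
    tc_eval (word_input sigma) F != tc_eval (word_input tau) F].
Proof.
move=> k_gt0 o0 wA wo cF.
exists (fun=> 1), (fun i => if i == 0%N then w else 1).
split=> [i|i|]; rewrite ?group1 //.
  by case: ifP.
rewrite !cF; try exact: perm_tuples_word_input.
rewrite !(Word_word_input _ o0) /wprefix big1_eq perm1 eqxx.
case: (k) k_gt0 => // k' _; rewrite big_nat_recl //= big1_eq mulg1.
by rewrite (negPf wo).
Qed.

End Words.

(** * Subgroups of powers of a simple group *)

Section SimpleGroups.
Local Open Scope group_scope.

(** The action of [G] on the cosets of [N] has as kernel the core of [N], which is normal and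
    proper, hence trivial; so [G] embeds in the symmetric group on the cosets. *)
Lemma simple_card_le_fact (gT : finGroupType) (G N : {group gT}) :
  simple G -> N \proper G -> #|G| <= (#|G : N|)`!.
Proof.
move=> /simpleP[_ simG] /andP[sNG nsGN].
have core1 : gcore N G = 1.
  case: (simG _ (gcore_normal sNG)) => // eG; case/negP: nsGN.
  by rewrite -{1}eG gcore_sub.
set S := rcosets N G.
pose f a := restr_perm S (actperm 'Rs a).
have fP a X : a \in G -> X \in S -> f a X = X :* a.
  move=> aG XS; have aN : actperm 'Rs a \in 'N(S | 'P).
    rewrite !inE; apply/subsetP => Y YS; rewrite inE /= apermE actpermE /=.
    by have /actsP/(_ a aG Y) -> := atrans_acts (transRs_rcosets N G).
  by rewrite /f (restr_permE aN XS) actpermE /= rcosetE.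
have injf : {in G &, injective f}.
  move=> a b aG bG fab; apply/eqP; rewrite eq_mulgV1 -in_set1.
  have -> : [set 1] = 'C(S | 'Rs) by rewrite astabRs_rcosets core1.
  apply/astabP => X XS.
  by rewrite /= rcosetE rcosetM -(fP a X) // fab fP // rcosetK.
rewrite -card_perm -(card_in_imset injf); apply/subset_leq_card/subsetP => s.
by case/imsetP=> a _ ->; exact: restr_perm_on.
Qed.

Section Commuting.
Variables (gT : finGroupType) (I : finType) (G : I -> {group gT}).
Variables (K : {set I}) (M : {group gT}) (a r : nat).
Hypothesis simG : {in K, forall i, simple (G i)}.
Hypothesis nabG : {in K, forall i, ~~ abelian (G i)}.
Hypothesis nsGM : {in K, forall i, G i <| M}.
Hypothesis cGG : {in K &, forall i j, i != j -> G i \subset 'C(G j)}.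
Hypothesis cardGi : {in K, forall i, #|G i| = a}.
(** Combined with [simple_card_le_fact], this bounds below by [r] the index of every proper subgroup
    of a factor. *)
Hypothesis min_r : forall m, a <= m`! -> r <= m.
Hypothesis r_gt0 : 0 < r.
Hypothesis r2_le : r ^ 2 <= a.
Implicit Type U : {group gT}.

Let missing U := [set j in K | ~~ (G j \subset U)].

Lemma commuting_TI i j : i \in K -> j \in K -> i != j -> G i :&: G j = 1.
Proof.
move=> iK jK ij; have /simpleP[_ /(_ (G i :&: G j)%G)] := simG iK.
have nsI : G i :&: G j <| G i.
  rewrite /normal subsetIl cents_norm // (subset_trans (cGG iK jK ij)) //.
  by rewrite centS ?subsetIr.
case=> //= eI; case/negP: (nabG iK); rewrite /abelian.
by apply: subset_trans (cGG iK jK ij) (centS _); rewrite -eI subsetIr.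
Qed.

(* If adjoining [G j] to [U] brings in a further [G i], then [U] meets
   [G i * G j] in the graph of an isomorphism. *)
Lemma linked_factors U i j : U \subset M -> i \in missing U -> j \in missing U ->
  i != j -> G i \subset U * G j ->
  U :&: G j = 1 /\ {in G j, forall y, exists2 g, g \in G i & y * g \in U}.
Proof.
rewrite !inE => sUM /andP[iK niU] /andP[jK njU] ij sGi.
have cij := cGG iK jK ij; have TIij := commuting_TI iK jK ij.
(* An element [x] of [G i] is [u * g] with [u] in [U] and [g] in [G j]. As [g] centralizes [G i],
   conjugation by [x] agrees there with conjugation by [u], so [U :&: G i] is normal in the simple
   group [G i]. *)
have TIi : U :&: G i = 1.
  have /simpleP[_ /(_ (U :&: G i)%G)] := simG iK; case=> //=; last first.
    by move/setIidPr=> siU; rewrite siU in niU.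
  rewrite /normal subsetIr; apply/subsetP => x xGi.
  rewrite inE; apply/subsetP => _ /imsetP[z /setIP[zU zi] ->].
  rewrite inE [X in _ && X]groupJ // andbT.
  have /mulsgP[u g uU gj ex] := subsetP sGi x xGi.
  have zxg : (z ^ x) ^ g^-1 = z ^ x.
    have zxc := subsetP cij _ (groupJ zi xGi).
    by apply/conjg_fixP/commgP; apply: (centP zxc); rewrite groupV.
  by rewrite -zxg -conjgM ex mulgK groupJ.
(* Orders are compared inside [D]. The modular law gives [#|U :&: D| = a * #|U :&: G j|], and the
   trivial intersection with [G i] gives [#|U :&: D| <= a]. Hence [U :&: G j] is trivial and
   [U :&: D] is also a complement of [G i]. *)
set D := (G i * G j)%g.
have cD : #|D| = (a * a)%N by rewrite /D TI_cardMg // !cardGi.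
have gD : group_set D.
  by rewrite /D; apply/comm_group_setP; apply: centC.
pose DG := Group gD.
have sD : D \subset U * G j.
  by rewrite /D -{2}(mulGid (G j)) mulgA mulSg.
have sjD : G j \subset D by rewrite mulG_subr.
have siD : G i \subset D by rewrite mulG_subl.
have modD : (U :&: D) * G j = D.
  by rewrite [U :&: D]setIC (group_modr U (sjD : G j \subset DG)); apply/setIidPl.
have cardL : (#|U :&: D| * a = a * a * #|U :&: G j|)%N.
  have := mul_cardG (U :&: DG)%G (G j); rewrite /= modD cD cardGi // => ->.
  by congr (_ * _)%N; rewrite -setIA (setIidPr sjD).
have TIL : (U :&: DG) :&: G i = 1.
  by rewrite /= -setIA (setIidPr siD).
have sLD : (U :&: D) * G i \subset D.
  by rewrite (mul_subG (_ : _ \subset DG)) ?subsetIr.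
have cardLi : #|(U :&: D) * G i| = (#|U :&: D| * a)%N.
  by rewrite (@TI_cardMg _ (U :&: DG)%G (G i)) ?cardGi.
have a_gt0 : 0 < a by rewrite -(cardGi iK).
have := subset_leq_card sLD; rewrite cardLi cardL cD => le_aa.
have cN : #|U :&: G j| = 1%N.
  apply/eqP; rewrite eqn_leq (cardG_gt0 (U :&: G j)) andbT.
  by rewrite -(leq_pmul2l (_ : 0 < a * a)) ?muln1 // muln_gt0 a_gt0.
split; first exact: (@card1_trivg _ (U :&: G j)%G).
have eD : (U :&: D) * G i = D.
  by apply/eqP; rewrite eqEcard sLD cardLi cardL cD cN muln1 leqnn.
move=> y yj; have := subsetP sjD y yj; rewrite -eD => /mulsgP[l g /setIP[lU _] gi ->].
by exists g^-1; rewrite ?groupV // mulgK.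
Qed.

(** Adjoining a missing [G j] to [U] multiplies the group by [#|G j : U :&: G j|], at least [r],
    which pays for [j]. If another factor is absorbed at the same time, it is the only one, and
    [U :&: G j] is trivial, so the index is [a] and [r ^ 2 <= a] pays for both. *)
Lemma index_ge_missing U : U \subset M -> r ^ #|missing U| <= #|M : U|.
Proof.
have [m] := ubnP #|missing U|; elim: m U => // m IH U ltm sUM.
have [->|[j jT]] := set_0Vmem (missing U); first by rewrite cards0 indexg_gt0.
have /setIdP[jK njU] := jT.
have /andP[sjM nMj] := nsGM jK.
have nUj := subset_trans sUM nMj.
pose W := (U <*> G j)%G.
have defW : W = U * G j :> {set gT} by rewrite /= norm_joinEl.
have sUW : U \subset W by rewrite /= joing_subl.
have sjW : G j \subset W by rewrite /= joing_subr.
have sWM : W \subset M by rewrite join_subG sUM.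
have sTW : missing W \subset missing U :\ j.
  apply/subsetP => i; rewrite !inE => /andP[-> niW].
  rewrite (contraNneq _ niW) => [|->//]; apply: contra niW => siU.
  exact: subset_trans sUW.
rewrite -(Lagrange_index sWM sUW).
have idxW : #|W : U| = #|G j : U :&: G j|.
  have := mul_cardG U (G j); rewrite -defW.
  rewrite -(Lagrange sUW) -(Lagrange (subsetIr U (G j))) /=.
  have := cardG_gt0 U; have := cardG_gt0 (U :&: G j) => /= h1 h2 e.
  by apply/eqP; rewrite -(eqn_pmul2l h2) -(eqn_pmul2l h1) mulnC -e mulnCA.
have ltN : U :&: G j \proper G j.
  by rewrite properE subsetIr subsetI negb_and njU.
have IHW : r ^ #|missing W| <= #|M : W|.
  apply: IH => //; apply: leq_trans (_ : #|missing U :\ j| < m).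
    by rewrite ltnS subset_leq_card.
  by move: ltm; rewrite (cardsD1 j (missing U)) jT.
have cTj : #|missing U| = #|missing U :\ j|.+1 by rewrite (cardsD1 j) jT.
have r_le : r <= #|W : U|.
  rewrite idxW; apply: min_r; rewrite -(cardGi jK).
  exact: simple_card_le_fact (simG jK) ltN.
have [eqT|neT] := eqVneq (missing W) (missing U :\ j).
  by rewrite cTj expnSr -eqT leq_mul.
have /properP[_ [i iTj niW]] : missing W \proper missing U :\ j.
  by rewrite properEneq neT.
have /setD1P[ij iT] := iTj.
have /setIdP[iK _] := iT.
have siW : G i \subset U * G j by move: niW; rewrite inE iK negbK -defW.
have [TIj graph_i] := linked_factors sUM iT jT ij siW.
(* Were a second [i'] absorbed, any [y] and [y'] in [G j] could be corrected by commuting elements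
   of [G i] and [G i'] to lie in [U]. The commutator of the corrected elements is still [[~ y, y']],
   which then lies in [U :&: G j = 1], making [G j] abelian. *)
have only_i : missing U :\ j :\ i \subset missing W.
  apply/subsetP => i' /setD1P[i'i /setD1P[i'j i'T]]; apply: contraT => ni'W.
  have /setIdP[i'K _] := i'T.
  have si'W : G i' \subset U * G j by move: ni'W; rewrite inE i'K negbK -defW.
  have [_ graph_i'] := linked_factors sUM i'T jT i'j si'W.
  case/negP: (nabG jK); apply/centsP => y yj y' y'j; apply/commgP.
  have [g gi yg] := graph_i y yj; have [g' gi' yg'] := graph_i' y' y'j.
  have cg : g \in 'C(G j) by apply: subsetP (cGG iK jK ij) _ gi.
  have cg' : g' \in 'C(G j) by apply: subsetP (cGG i'K jK i'j) _ gi'.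
  have cgg' : commute g g'.
    by apply: (centP (subsetP (cGG iK i'K _) g gi)) => //; rewrite eq_sym.
  have cgy' : commute g y' by exact: (centP cg).
  have cyg' : commute g' y by exact: (centP cg').
  have eR : [~ y * g, y' * g'] = [~ y, y'].
    rewrite !commgEl conjMg.
    have -> : g ^ (y' * g') = g.
      by apply/conjg_fixP/commgP; apply: commuteM.
    have -> : y ^ (y' * g') = y ^ y'.
      rewrite conjgM; apply/conjg_fixP/commgP.
      by apply/commute_sym/(centP cg'); rewrite groupJ.
    have cgyy : commute g (y^-1 * y ^ y').
      by apply: (centP cg); rewrite groupM ?groupV ?groupJ.
    by rewrite invMg -mulgA (mulgA y^-1) -cgyy mulKg.
  by rewrite -in_set1 -[[set 1]]TIj inE -{1}eR !groupR.
have a_le : a <= #|W : U| by rewrite idxW TIj indexg1 cardGi.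
rewrite cTj (cardsD1 i) iTj add1n -addn2 expnD leq_mul //; last exact: leq_trans a_le.
by apply: leq_trans IHW; rewrite leq_pexp2l // subset_leq_card.
Qed.

End Commuting.
End SimpleGroups.

(** * The alternating case *)

(** In terms of [Alt_n] this is [n ^ 2 <= #|Alt_n|], the instance of [r2_le] with [r = n]; it fails
    at [n = 4]. *)
Lemma fact_sq_bound n : 5 <= n -> 2 * n ^ 2 <= n`!.
Proof.
case: n => [|[|[|n]]] // n_ge; rewrite !factS expnS expn1 mulnCA leq_mul2l /=.
have le_n : 2 * n.+3 <= n.+2 * n.+1 by nia.
by apply: leq_trans le_n _; rewrite leq_mul2l /= leq_pmulr ?fact_gt0.
Qed.

(** For [m < n] one has [m! <= (n-1)!], which is less than [n!/2]. This is the instance of [min_r]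
    with [r = n]. *)
Lemma Alt_le_fact n m : 5 <= n -> #|('Alt_('I_n))%g| <= m`! -> n <= m.
Proof.
move=> n_ge; have := @card_Alt 'I_n; rewrite card_ord => /(_ (ltnW (ltnW (ltnW n_ge)))).
case: n n_ge => // n n_ge eA leA; rewrite leqNgt; apply/negP => m_lt.
have : m`! <= n`! by apply: leq_fact; rewrite -ltnS.
move: eA; rewrite factS; have := fact_gt0 n; nia.
Qed.

Lemma Alt_moves n (a : 'I_n) : 5 <= n -> exists2 x, x \in ('Alt_('I_n))%g & x a != a.
Proof.
move=> n_ge; have tr := @Alt_trans 'I_n; rewrite card_ord in tr.
have {}tr : [transitive 'Alt_('I_n), on setT | 'P]%g.
  by apply: ntransitive1 tr; case: n n_ge a => [|[|[|]]].
have [b ba] : exists b : 'I_n, b != a.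
  have lt0 : 0 < n by lia.
  have lt1 : 1 < n by lia.
  have [<-|ne] := eqVneq (Ordinal lt0) a; first by exists (Ordinal lt1).
  by exists (Ordinal lt0).
have [x xA eb] := atransP2 tr (in_setT a) (in_setT b).
by exists x => //; move: ba; rewrite eb.
Qed.

Section Blocks.
Implicit Types (T : seq nat) (s t : nat).

Let inside s t T := count (fun j => s < j < t) T.

(** Pigeonhole, by cutting at one point of [T] and keeping the longer of the blocks found on its two
    sides. The cut point itself accounts for the successor. *)
Lemma long_block T s t : s < t -> exists s' t',
  [/\ s <= s', s' < t', t' <= t, forall j, j \in T -> ~~ (s' < j < t') &
      t - s <= (inside s t T).+1 * (t' - s')].
Proof.
have [m] := ubnP (inside s t T); elim: m s t => // m IH s t ltm st.
have [/hasP[x xT /andP[sx xt]]|no_x] := boolP (has (fun j => s < j < t) T); last first.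
  exists s, t; split=> //; last by rewrite leq_pmull.
  by move=> j jT; apply: contra no_x => ?; apply/hasP; exists j.
have split_x : inside s x T + inside x t T < inside s t T.
  rewrite /inside; elim: (T) xT => //= y T' IHT; rewrite inE => /orP[/eqP <-|/IHT].
    have : forall T1, count (fun j => s < j < x) T1 + count (fun j => x < j < t) T1
                      <= count (fun j => s < j < t) T1.
      by elim=> //= z T1; lia.
    by move/(_ T'); lia.
  by lia.
have [s1 [t1 [ss1 st1 tx1 no1 len1]]] := IH s x ltac:(lia) sx.
have [s2 [t2 [xs2 st2 tt2 no2 len2]]] := IH x t ltac:(lia) xt.
have [le12|lt21] := leqP (t1 - s1) (t2 - s2).
  by exists s2, t2; split=> //; [lia | nia].
by exists s1, t1; split=> //; [lia | nia].
Qed.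

End Blocks.

(** * Powers of the alternating group inside the gauge group *)

Section GaugePowers.
Variables n k : nat.
Local Open Scope group_scope.
Implicit Types (A : {group 'S_n}) (K L : {set 'I_k.+1}) (i j : 'I_k.+1).

Definition single (j : 'I_k.+1) (x : 'S_n) : gauge n k :=
  [ffun i => if i == j then x else 1].

Lemma single_gpow A L j x : x \in A -> j \in L -> single j x \in gpow A L.
Proof.
move=> xA jL; apply/gpowP => i; rewrite ffunE.
by have [->|_] := eqVneq; [rewrite jL | case: ifP; rewrite group1].
Qed.

Lemma gpow_sub_singles A L (U : {group gauge n k}) :
  {in L, forall j, gpow A [set j] \subset U} -> gpow A L \subset U.
Proof.
have [m] := ubnP #|L|; elim: m L => // m IH L ltm sLU.
apply/subsetP => g gL; have [L0|[j jL]] := set_0Vmem L.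
  suff -> : g = 1 by rewrite group1.
  by apply/ffunP => i; rewrite gauge1 (gpow_out gL) // L0 inE.
have gj : single j (g j) \in U.
  by apply: (subsetP (sLU j jL)); rewrite single_gpow ?set11 ?(gpow_mem _ gL).
rewrite -(groupMl _ (groupVr gj)); apply: (subsetP (IH (L :\ j) _ _)).
- by move: ltm; rewrite (cardsD1 j L) jL.
- by move=> i /setD1P[_ /sLU].
apply/gpowP => i; rewrite gaugeM gaugeV ffunE !inE.
have [->|ij] := eqVneq; first by rewrite mulVg set11.
by rewrite /= invg1 mul1g; exact: (gpowP _ _ _ gL i).
Qed.

Lemma gpow1_isog A j : A \isog gpow A [set j].
Proof.
have -> : gpow A [set j] = set1gXn (i := j) A; last exact: isog_setXn.
rewrite set1gXnE; apply/setP => g; rewrite !in_setXn; apply: eq_forallb => i.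
rewrite inE; have [->|ij] := eqVneq i j; first by rewrite dfwith_in.
by rewrite dfwith_out // eq_sym.
Qed.

Lemma gpow1_cent A i j : i != j -> gpow A [set i] \subset 'C(gpow A [set j]).
Proof.
move=> ij; apply/centsP => g gi h hj; apply/ffunP => l; rewrite !gaugeM.
have [->|li] := eqVneq l i; last by rewrite (gpow_out gi) ?inE // mulg1 mul1g.
by rewrite (gpow_out hj) ?inE // mulg1 mul1g.
Qed.

Lemma gpow1_normal A K j : j \in K -> gpow A [set j] <| gpow A K.
Proof.
move=> jK; apply/andP; split; first by rewrite gpowS ?sub1set.
apply/subsetP => g gK; rewrite inE; apply/subsetP => _ /imsetP[h hj ->].
apply/gpowP => i; rewrite conjgE !gaugeM gaugeV.
case: ifP => [_|/negbT ij]; last by rewrite (gpow_out hj ij) mul1g mulVg.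
by rewrite !groupM ?groupV ?(gpow_mem _ gK) ?(gpow_mem _ hj).
Qed.

(** The set [T] consists of the vertices whose factor is not contained in [U]. *)
Lemma Alt_power_index (U : {group gauge n k}) K : 5 <= n ->
  U \subset gpow 'Alt_('I_n) K -> exists T : {set 'I_k.+1},
  [/\ T \subset K, gpow 'Alt_('I_n) (K :\: T) \subset U &
      n ^ #|T| <= #|gpow 'Alt_('I_n) K : U|].
Proof.
move=> n_ge sUK; pose G j := [group of gpow ('Alt_('I_n))%G [set j]].
have simG j : simple (G j).
  by rewrite -(isog_simple (gpow1_isog _ j)) simple_Alt5 // card_ord.
have nabG j : ~~ abelian (G j).
  rewrite -(isog_abelian (gpow1_isog _ j)); apply/negP => /abelian_sol.
  by rewrite solvable_AltF ?card_ord.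
exists [set j in K | ~~ (G j \subset U)]; split.
- by apply/subsetP => j /setIdP[].
- apply: (gpow_sub_singles (A := ('Alt_('I_n))%G)) => j.
  by rewrite !inE => /andP[+ jK]; rewrite jK negbK.
apply: (@index_ge_missing _ _ G K [group of gpow ('Alt_('I_n))%G K]
  #|'Alt_('I_n)|) => //.
- by move=> j jK; exact: gpow1_normal.
- by move=> i j _ _; exact: gpow1_cent.
- by move=> j _; rewrite /= card_gpow cards1 expn1.
- by move=> m; exact: Alt_le_fact.
- by lia.
have := fact_sq_bound n_ge; have := @card_Alt 'I_n; rewrite card_ord.
by move=> /(_ ltac:(lia)) <-; rewrite leq_pmul2l.
Qed.

End GaugePowers.

Section AltBound.
Variables n k : nat.
Hypothesis n_ge5 : 5 <= n.
Local Notation A := ('Alt_('I_n))%G.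

(** The interval from [s] to [t] is where the two words may still differ, and [q] accumulates the
    factors [t.+1] of the gates already passed. *)
Lemma Alt_formula_bound (F : tc (wvar n k)) s t q sigma tau :
  s < t -> t <= k -> k <= q * (t - s) ->
  fixed_by (@rho n k) (gpow A (itv k s t)) F ->
  (forall i, i < k -> sigma i \in A) -> (forall i, i < k -> tau i \in A) ->
  (forall i, i < k -> ~~ (s <= i < t) -> sigma i = tau i) ->
  tc_eval (word_input sigma) F != tc_eval (word_input tau) F ->
  exists ts : seq nat, [/\ size ts <= tc_depth F,
    k <= q * \prod_(x <- ts) x.+1 & n ^ sumn ts <= tc_size F].
Proof.
elim/tc_nested_ind: F s t q sigma tau => [b|v e|cs IH] s t q sigma tau
  st tk kq fF sA tA off neq.
- by rewrite eqxx in neq.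
- exists [::]; split=> //; rewrite big_nil muln1.
  (* The literal must read a letter of the interval. In an interval of length at least 2, an end of
     that edge would be an interior vertex, where [Alt_n] moves the index and so the literal. *)
  suff t_le : t <= s.+1 by nia.
  have vI : s <= v.1.1 < t.
    apply: contraT => nI; move: neq; rewrite /= /word_input.
    by rewrite (off _ _ nI) ?eqxx.
  have fix_v u : u \in gpow A (itv k s t) -> rho u v = v.
    by move=> /fF; exact: tc_iso_lit_inv.
  have no_fix (j : 'I_k.+1) (x : 'I_n) : s < j < t ->
      (forall u, u \in gpow A (itv k s t) -> ((u j)^-1)%g x = x) -> False.
    move=> jI fx; have [y yA /eqP] := Alt_moves x n_ge5; apply.
    have := fx (single j y^-1)%g; rewrite ffunE eqxx invgK; apply.
    by apply: single_gpow; rewrite ?groupV // inE.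
  rewrite leqNgt; apply/negP => lt_t; have := ltn_ord v.1.1.
  have [lt_si|le_is] := ltnP s v.1.1 => vk.
    apply: (no_fix (inord v.1.1) v.1.2); first by rewrite inordK; lia.
    by move=> u /fix_v; case: (v) => [[i a] c] [].
  apply: (no_fix (inord v.1.1.+1) v.2); first by rewrite inordK; lia.
  by move=> u /fix_v; case: (v) => [[i a] c] [].
pose K := itv k s t; pose U := [group of gpow A K].
have [c c_cs sens] := @sensitive_child _ _ _ U _ _ _ fF neq.
pose U' := stab_group (@rho1 n k) (@rhoM n k) U c.
have [T [sTK sT idxT]] := Alt_power_index n_ge5 (stab_sub _ U c : U' \subset gpow A K).
have [s' [t' [ss' st' tt' noT len]]] := long_block [seq val j | j <- enum T] st.
have cT : count (fun j => s < j < t) [seq val j | j <- enum T] <= #|T|.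
  by rewrite (leq_trans (count_size _ _)) // size_map -cardE.
(* The difference is pushed onto letter [s'], the first of the long block, so that the new words
   agree outside that block. *)
have [|eta etaU eta_off] := @gauge_to_single_difference n k A sigma tau s t s'
  _ tk sA tA off; first by lia.
have [u uU neq'] := sens eta etaU.
have uA : u \in gpow A setT by apply: (subsetP (gpowS _ _)) uU; rewrite ?subsetT.
have etaA : eta \in gpow A setT by apply: (subsetP (gpowS _ _)) etaU; rewrite ?subsetT.
have IHc := (List.Forall_forall _ _).1 IH c c_cs.
have [||||||||ts [sz pr le]] :=
  IHc s' t' (q * #|T|.+1) (wact sigma u) (wact (wact tau eta) u).
- by [].
- exact: leq_trans tt' tk.
- apply: leq_trans kq _; rewrite -mulnA leq_mul2l (leq_trans len) ?orbT //.
  by rewrite leq_mul2r ltnS cT orbT.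
- apply: fixed_byS (fixed_by_stab (U := U) (c := c)).
  apply: subset_trans sT; apply: gpowS => //; apply/subsetP => j.
  rewrite !inE => /andP[sj jt].
  rewrite (leq_ltn_trans ss' sj) (leq_trans jt tt') !andbT.
  apply/negP => jT; have := noT j; by rewrite sj jt map_f ?mem_enum // => /(_ isT).
- exact: wact_mem sA uA.
- exact: wact_mem (wact_mem tA etaA) uA.
- move=> i ik; rewrite negb_and => out; rewrite /wact.
  congr (_ * _ * _)%g; rewrite -[RHS]/(wact tau eta i) eta_off //.
  by apply: contraTneq out => ->; rewrite leqnn st'.
- by move: neq'; rewrite !word_input_rho (eq_word_input (fun i _ => wactM tau eta u i)).
exists (#|T| :: ts); split.
- by rewrite /= (leq_ltn_trans sz) // tc_depth_child.
- by rewrite big_cons mulnA.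
have := orbit_size (@rho1 n k) (@rhoM n k) fF c_cs; apply: leq_trans.
by rewrite /= expnD leq_mul.
Qed.

End AltBound.

(** * The abelian case *)

(* A maximal strictly descending chain of the intersections with [W' * Z i]. *)
Lemma descending_chain (gT : finGroupType) (I : eqType) (light : pred I)
    (Z : I -> {group gT}) (M W' E : {group gT}) (p : nat) :
  abelian M -> (forall i, Z i \subset M) -> (p.-group E)%g ->
  W' \subset E -> E \subset M ->
  exists ss : seq I, [/\ all light ss, p ^ size ss * #|W'| <= #|E| &
    forall i x, light i -> x \in E -> {in ss, forall j, x \in Z j} ->
      x \in (W' * Z i)%g].
Proof.
move=> abM sZM; have [m] := ubnP #|E|; elim: m E => // m IH E ltm pE sWE sEM.
have sWM := subset_trans sWE sEM.
have [stop|/existsPNP[i]] :=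
  pselect (forall i, light i -> E \subset (W' * Z i)%g).
  exists [::]; split=> //; first by rewrite mul1n subset_leq_card.
  by move=> i x /stop /subsetP sEZ /sEZ.
move=> li nsE; pose E1 := (E :&: (W' <*> Z i))%G.
have defJ : (W' <*> Z i = W' * Z i)%g.
  by rewrite cent_joinEl // (centsS (sZM i)) // (subset_trans sWM).
have prE1 : E1 \proper E.
  by rewrite properE subsetIl subsetI subxx /= defJ; apply/negP.
have [||||ss [lss cE1 spec]] := IH E1.
- exact: leq_trans (proper_card prE1) ltm.
- exact: pgroupS (proper_sub prE1) pE.
- by rewrite subsetI sWE joing_subl.
- exact: subset_trans (proper_sub prE1) sEM.
exists (i :: ss); split; first by rewrite /= li.
  rewrite /= expnS -mulnA (leq_trans (leq_mul (leqnn p) cE1)) //.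
  rewrite -(Lagrange (proper_sub prE1)) mulnC leq_mul2l; apply/orP; right.
  (* A proper subgroup of a [p]-group has index divisible by [p], so each link of the chain
     contributes a factor [p]. *)
  have idx_gt1 : 1 < #|E : E1|%g by rewrite indexg_gt1 proper_subn.
  have p_idx : p.-nat #|E : E1|%g by exact: pnat_dvd (dvdn_indexg _ _) pE.
  have [q q_pr q_dvd] := pdivP idx_gt1.
  move/pnatP: p_idx => /(_ (ltnW idx_gt1) q q_pr q_dvd)/eqP <-.
  exact: dvdn_leq (ltnW idx_gt1) q_dvd.
move=> j x lj xE xZ; apply: spec => //.
  by rewrite inE xE /= defJ -[x]mul1g mem_mulg // xZ // mem_head.
by move=> l lss'; apply: xZ; rewrite inE lss' orbT.
Qed.


Section AbelianBound.
Variables n k : nat.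
Variables (C V : {group 'S_n}) (p : nat).
Hypothesis k_gt0 : 0 < k.
Hypothesis abC : abelian C.
Hypothesis sVC : V \subset C.
Hypothesis p_pr : prime p.
Hypothesis pV : (p.-group V)%g.
Implicit Types (S : {set 'I_k}) (U : {group gauge n k}) (g : gauge n k).
Implicit Types (sigma tau : nat -> 'S_n).

Local Notation GC := (gpow C [set: 'I_k.+1]).
Local Notation GV := (gpow V [set: 'I_k.+1]).

Lemma abelian_gpow : abelian GC.
Proof.
apply/centsP => g gC h hC; apply/ffunP => j; rewrite !gaugeM.
by apply: (centsP abC); [exact: gpow_mem gC | exact: gpow_mem hC].
Qed.

Lemma gpow_pgroup : (p.-group GV)%g.
Proof. by move: pV; rewrite /pgroup card_gpow pnatX => ->. Qed.

(** Since [C] is abelian, a gauge fixes a letter exactly when it takes equal values at both ends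
    ([wact_flatP]). These are therefore the [V]-valued gauges that fix every letter in [S]. *)
Definition flat_set S : {set gauge n k} :=
  [set g in GV | [forall i in S, g (inord i) == g (inord i.+1)]].

Lemma flatP S g : reflect
  (g \in GV /\ {in S, forall i : 'I_k, g (inord i) = g (inord i.+1)})
  (g \in flat_set S).
Proof.
apply: (iffP setIdP) => -[gV h]; split=> //.
  by move=> i iS; have /forall_inP/(_ i iS)/eqP := h.
by apply/forall_inP => i iS; apply/eqP/h.
Qed.

Lemma group_set_flat S : group_set (flat_set S).
Proof.
apply/group_setP; split; first by apply/flatP; split=> // i _; rewrite !gauge1.
move=> g h /flatP[gV gf] /flatP[hV hf]; apply/flatP; split; first exact: groupM.
by move=> i iS; rewrite !gaugeM gf ?hf.
Qed.

Canonical flat S := Group (group_set_flat S).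

Lemma flat_sub S : flat S \subset GV.
Proof. by apply/subsetP => g /flatP[]. Qed.

Lemma eq_wact sigma tau g i : sigma i = tau i -> wact sigma g i = wact tau g i.
Proof. by rewrite /wact => ->. Qed.

Lemma wact_flatP sigma g i : sigma i \in C -> g \in GC ->
  wact sigma g i = sigma i <-> g (inord i) = g (inord i.+1).
Proof.
move=> sC gC; have ci : commute (g (inord i)) (sigma i).
  by apply: (centsP abC) => //; exact: gpow_mem gC.
rewrite /wact; split=> [|<-]; last by rewrite -mulgA -ci mulKg.
move/(congr1 (fun x => (sigma i)^-1 * (g (inord i) * x)))%g.
by rewrite ci mulKg -!mulgA mulKVg mulKg => ->.
Qed.

Lemma wact_commute sigma g h i : g \in GC -> h \in GC ->
  wact (wact sigma g) h i = wact (wact sigma h) g i.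
Proof. by move=> gC hC; rewrite -!wactM (centsP abelian_gpow g gC h hC). Qed.

(** The group [U0] is the symmetry group left at the leaf. The last two conclusions multiply the
    stabilizer indices along the path, once in the whole groups, which controls size, and once in
    their [V]-valued parts, which defines [ts]. *)
Lemma abelian_formula_bound (F : tc (wvar n k)) U q sigma tau :
  U \subset GC -> fixed_by (@rho n k) U F ->
  (forall i, i < k -> sigma i \in C) -> (forall i, i < k -> tau i \in C) ->
  (forall S, q * #|S| < k -> exists2 u, u \in U :&: GV &
     {in S, forall i : 'I_k, wact tau u i = sigma i}) ->
  tc_eval (word_input sigma) F != tc_eval (word_input tau) F ->
  exists (U0 : {group gauge n k}) (ts : seq nat),
    [/\ U0 \subset U, size ts <= tc_depth F, k <= q * \prod_(x <- ts) x.+1,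
        #|U| <= #|U0| * tc_size F &
        p ^ sumn ts * #|U0 :&: GV| <= #|U :&: GV|].
Proof.
elim/tc_nested_ind: F U q sigma tau => [b|v e|cs IH] U q sigma tau
  sUC fF sC tC conn neq.
- by rewrite eqxx in neq.
- exists U, [::]; split=> //=; rewrite ?muln1 ?mul1n ?big_nil ?muln1 //.
  (* If [q < k], the single letter read by the literal is a small set, so a symmetry of the literal
     matches the two words there. *)
  rewrite leqNgt; apply/negP => q_lt; case/eqP: neq.
  have [|u /setIP[uU _] /(_ v.1.1 (set11 _)) eq_u] := conn [set v.1.1].
    by rewrite cards1 muln1.
  rewrite -(fixed_by_eval (word_input tau) fF uU) word_input_rho /= /word_input.
  by rewrite eq_u.
have [c c_cs sens] := sensitive_child fF neq.
pose U' := stab_group (@rho1 n k) (@rhoM n k) U c.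
have sU'U : U' \subset U := stab_sub _ U c.
pose W := (U :&: [group of GV])%G; pose W' := (U' :&: [group of GV])%G.
have sW'W : W' \subset W by rewrite /= setSI.
have sVCg : GV \subset GC by rewrite gpowS.
have sWC : W \subset GC by rewrite (subset_trans _ sUC) // subsetIl.
have pW : (p.-group W)%g by rewrite (pgroupS _ gpow_pgroup) // subsetIr.
pose t := logn p #|W : W'|%g.
have idxt : #|W : W'|%g = p ^ t.
  by have [m em] := p_natP (pnat_dvd (dvdn_indexg W W') pW); rewrite /t em pfactorK.
pose light S := q * t.+1 * #|S| < k.
have [ss [lss css spec]] := @descending_chain _ _ light flat [group of GC] W' W p
  abelian_gpow (fun S => subset_trans (flat_sub S) sVCg) pW sW'W sWC.
have ss_le : size ss <= t.
  rewrite -(leq_exp2l _ _ (prime_gt1 p_pr)) -idxt.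
  by rewrite -(leq_pmul2r (cardG_gt0 W')) mulnC (mulnC #|_ : _|%g) Lagrange // mulnC.
(* The chain has at most [t] light sets, so [q * t.+1 * #|B| <= t * k.-1]. A further light set adds
   at most [k.-1], and dividing by [t.+1] shows that its union with [B] is still small for [q]. *)
pose B := \bigcup_(S <- ss) S.
have cardB : q * t.+1 * #|B| <= size ss * k.-1.
  rewrite /B; elim: (ss) lss => [|S ss' IHs] /=; first by rewrite big_nil cards0 muln0.
  case/andP=> lS /IHs le_ss'; rewrite big_cons mulSn.
  apply: leq_trans (leq_mul (leqnn _) (leq_card_setU _ _)) _; rewrite mulnDr leq_add //.
  by rewrite -ltnS prednK.
have light_union S : light S -> q * #|S :|: B| < k.
  move=> lS; suff : q * #|S :|: B| <= k.-1 by rewrite -ltnS prednK.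
  rewrite -(leq_pmul2l (ltn0Sn t)) mulnCA mulnA.
  apply: leq_trans (leq_mul (leqnn _) (leq_card_setU _ _)) _.
  rewrite mulnDr mulSn leq_add //; first by rewrite -ltnS prednK.
  by apply: leq_trans cardB _; rewrite leq_mul2r ss_le orbT.
have light0 : light set0 by rewrite /light cards0 muln0.
have [|eta etaW eta_B] := conn B; first by have := light_union _ light0; rewrite set0U.
have /setIP[etaU etaV] := etaW.
have [u uU neq'] := sens eta etaU.
have uC := subsetP sUC u uU; have etaC := subsetP sUC eta etaU.
have IHc := (List.Forall_forall _ _).1 IH c c_cs.
have [||||||U0 [ts [sU0 sz pr cU cV]]] :=
  IHc U' (q * t.+1) (wact sigma u) (wact (wact tau eta) u).
- exact: subset_trans sU'U sUC.
- exact: fixed_by_stab.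
- exact: wact_mem sC uC.
- exact: wact_mem (wact_mem tC etaC) uC.
(* Both [eta] and [v] match the words on [B], so [eta^-1 * v] is flat on every set of the chain. By
   [spec] it is [w * z] with [w] in [W'] and [z] flat on [S]; as [z] leaves the letters in [S]
   alone, [w] already matches the words there. *)
- move=> S lS; have [v vW v_SB] := conn (S :|: B) (light_union S lS).
  have vW' : (eta^-1 * v)%g \in W by rewrite groupM ?groupV.
  have vC := subsetP sWC _ vW'.
  have act_v i : i \in S :|: B -> wact (wact tau eta) (eta^-1 * v)%g i = sigma i.
    by move=> /v_SB <-; rewrite -wactM mulKVg.
  have v_flat : {in ss, forall S', (eta^-1 * v)%g \in flat S'}.
    move=> S' S'ss; apply/flatP; split; first by case/setIP: vW'.
    move=> i iS'; have iB : i \in B by rewrite /B (big_rem S') // inE iS'.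
    apply/(wact_flatP (sigma := wact tau eta) _ vC).
      exact: wact_mem tC etaC _ (ltn_ord i).
    by rewrite eta_B // act_v // inE iB orbT.
  have /mulsgP[w z wW' /flatP[zV zf] ev] := spec S _ lS vW' v_flat.
  exists w => // i iS.
  have wC : w \in GC by apply: (subsetP sWC); exact: (subsetP sW'W).
  have zC := subsetP sVCg z zV.
  rewrite wact_commute //; apply: eq_wact.
  have <- : wact (wact tau eta) (eta^-1 * v)%g i = sigma i by rewrite act_v // inE iS.
  rewrite ev wactM; apply/esym/wact_flatP => //; last exact: zf.
  exact: wact_mem (wact_mem tC etaC) wC _ (ltn_ord i).
- by move: neq'; rewrite !word_input_rho (eq_word_input (fun i _ => wactM tau eta u i)).
exists U0, (t :: ts); split.
- exact: subset_trans sU0 sU'U.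
- by rewrite /= (leq_ltn_trans sz) // tc_depth_child.
- by rewrite big_cons mulnA.
- have := orbit_size (@rho1 n k) (@rhoM n k) fF c_cs => le_c.
  rewrite -(Lagrange sU'U) (leq_trans (leq_mul cU (leqnn _))) //.
  by rewrite -mulnA leq_mul2l mulnC le_c orbT.
by rewrite /= expnD -mulnA -(Lagrange sW'W) idxt mulnC leq_mul2r cV orbT.
Qed.

End AbelianBound.

(** * Profiles of formulas for the word problem *)

Section WordBounds.
Variables (n k : nat) (o : 'I_n) (F : tc (wvar n k)).
Hypothesis k_gt0 : 0 < k.
Hypothesis o0 : val o = 0.
Hypothesis invF : tc_invariant (@SnPow n k) F.
Hypothesis compF : tc_computes (@perm_tuples n k) (@Word n k) F.

Definition has_profile (m : nat) := exists ts : seq nat,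
  [/\ size ts <= tc_depth F, k <= \prod_(x <- ts) x.+1 & m ^ sumn ts <= tc_size F].

Lemma Alt_word_bound : 5 <= n -> has_profile n.
Proof.
move=> n_ge; have [w wA wo] := Alt_moves o n_ge.
have [sigma [tau [sA tA neq]]] :=
  computing_formula_distinguishes (A := 'Alt_('I_n)%G) k_gt0 o0 wA wo compF.
have [] // := @Alt_formula_bound n k n_ge F 0 k 1 sigma tau.
- by rewrite subn0 mul1n.
- exact: tc_invariant_gauge.
- by move=> i ->.
by move=> ts []; rewrite mul1n; exists ts.
Qed.

(** At the root [#|U|] equals the [e]-th power of the order of its [V]-valued part, while at the
    leaf it is at most that power. Hence the index bound for the [V]-valued parts, raised to the
    power [e], becomes a bound on size with base [p ^ e = n]. *)
Lemma abelian_word_bound (C V : {group 'S_n}) (p e : nat) (w : 'S_n) :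
  abelian C -> V \subset C -> prime p -> #|V| = p -> #|C| = n -> n = p ^ e ->
  (forall U : {group gauge n k}, U \subset gpow C setT ->
     #|U| <= #|U :&: gpow V setT| ^ e) ->
  w \in V -> w o != o -> has_profile n.
Proof.
move=> abC sVC p_pr cV cC en card_le wV wo.
have [sigma [tau [sV tV neq]]] :=
  computing_formula_distinguishes k_gt0 o0 wV wo compF.
pose U := [group of gpow C (itv k 0 k)].
have sUC : U \subset gpow C setT by rewrite gpowS ?subsetT.
have sVU : gpow V (itv k 0 k) \subset U :&: gpow V setT.
  by rewrite subsetI !gpowS ?subsetT.
have pV : (p.-group V)%g by rewrite /pgroup cV pnat_id.
have conn (S : {set 'I_k}) : 1 * #|S| < k -> exists2 u, u \in U :&: gpow V setT &
    {in S, forall i : 'I_k, wact tau u i = sigma i}.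
  (* With [q = 1], a small set misses some letter [i0], onto which the whole difference can be
     moved. *)
  rewrite mul1n => S_lt; have [i0 i0S] : exists i0, i0 \notin S.
    apply/existsP; rewrite -negb_forall; apply: contraTN S_lt => /forallP allS.
    rewrite -leqNgt -[X in X <= _]card_ord -cardsT.
    by apply/subset_leq_card/subsetP => i _.
  have [||||| eta etaV eta_off] := @gauge_to_single_difference n k V sigma tau 0 k i0.
  - by rewrite ltn_ord.
  - by [].
  - by move=> i _.
  - by move=> i _.
  - by move=> i ->.
  exists eta; first exact: (subsetP sVU).
  by move=> i iS; apply: eta_off => //; apply: contraNneq i0S => /val_inj <-.
have [U0 [ts [sU0 sz pr cU cUV]]] := abelian_formula_bound k_gt0 abC sVC p_pr pV
  sUC (tc_invariant_gauge invF) (fun i _ => subsetP sVC _ (sV i))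
  (fun i _ => subsetP sVC _ (tV i)) conn neq.
exists ts; rewrite mul1n in pr; split=> //.
have eUV : U :&: gpow V setT = gpow V (itv k 0 k).
  apply/eqP; rewrite eqEsubset sVU andbT; apply/subsetP => g /setIP[gC gV].
  apply/gpowP => j; case: ifP => [_|/negbT jI]; first exact: gpow_mem gV.
  by rewrite (gpow_out gC jI).
have := card_le U0 (subset_trans sU0 sUC) => leU0.
have c_gt0 : 0 < #|U0 :&: gpow V setT|.
  by rewrite (cardG_gt0 (U0 :&: [group of gpow V setT])).
rewrite -(leq_pmul2l (_ : 0 < #|U0 :&: gpow V setT| ^ e)) ?expn_gt0 ?c_gt0 //.
apply: leq_trans (leq_mul leU0 (leqnn _)).
apply: leq_trans cU; rewrite /= card_gpow cC.
have powE i : n ^ i = (p ^ i) ^ e by rewrite {1}en -!expnM mulnC.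
rewrite !powE mulnC -expnMn; rewrite eUV card_gpow cV in cUV.
by case: (e) => // e'; rewrite leq_exp2r.
Qed.

End WordBounds.

(** * Regular cyclic groups and small degrees *)

Section Rotation.
Variable m : nat.
Local Open Scope group_scope.

Definition rotation : 'S_m.+2 := perm (@GRing.addrI 'I_m.+2 1%R).

Lemma rotationX i (x : 'I_m.+2) : (rotation ^+ i) x = (i%:R + x)%R.
Proof.
elim: i x => [|i IH] x; first by rewrite expg0 perm1 GRing.add0r.
by rewrite expgSr permM IH permE GRing.addrA -GRing.natr1 [(1 + _)%R]GRing.addrC.
Qed.

Lemma rotationX_eq1 i : (rotation ^+ i == 1) = (m.+2 %| i).
Proof.
have natE : ((i%:R : 'I_m.+2) == 0)%R = (m.+2 %| i).
  by rewrite Zp_nat -val_eqE.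
rewrite -natE; apply/eqP/eqP => [e|e].
  by have := rotationX i 0%R; rewrite e perm1 GRing.addr0.
by apply/permP => x; rewrite rotationX e GRing.add0r perm1.
Qed.

Lemma order_rotation : #[rotation] = m.+2.
Proof.
apply/eqP; rewrite eqn_dvd -rotationX_eq1 expg_order eqxx andbT.
by rewrite order_dvdn rotationX_eq1.
Qed.

End Rotation.

(** In an abelian 2-group the order is the product of the orders of the subgroup of elements of
    order dividing 2 and the subgroup of squares; here both are [V]-valued. *)
Lemma card_le_sq_involutions n k (C V : {group 'S_n}) :
  abelian C -> (2.-group C)%g -> (forall x, x \in C -> (x ^+ 2)%g \in V) ->
  (forall x, x \in C -> (x ^+ 2 = 1)%g -> x \in V) ->
  forall U : {group gauge n k}, U \subset gpow C setT ->
  #|U| <= #|U :&: gpow V setT| ^ 2.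
Proof.
move=> abC C2 sqV invV U sUC.
have abU : abelian U := abelianS sUC (abelian_gpow k abC).
have U2 : (2.-group U)%g := pgroupS sUC (gpow_pgroup k C2).
have gaugeX (g : gauge n k) j i : ((g ^+ i) j = g j ^+ i)%g.
  by elim: i => [|i IH]; rewrite ?gauge1 // !expgS gaugeM IH.
have memV (g : gauge n k) : (forall j, g j \in V) -> g \in gpow V setT.
  by move=> gV; apply/gpowP => j; rewrite inE.
rewrite -(mul_card_Ohm_Mho_abelian 1 abU) -mulnn leq_mul // subset_leq_card //.
  rewrite (OhmE 1 U2) gen_subG; apply/subsetP => g /LdivP[gU g2].
  rewrite inE gU; apply: memV => j; apply: invV.
    exact: gpow_mem (subsetP sUC g gU).
  by rewrite -gaugeX; move: g2; rewrite expn1 => ->; rewrite gauge1.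
rewrite (MhoE 1 U2) gen_subG; apply/subsetP => _ /imsetP[g gU ->].
rewrite expn1 inE groupX //; apply: memV => j; rewrite gaugeX.
exact: sqV (gpow_mem _ (subsetP sUC g gU)).
Qed.

(** Degrees 2 and 3 use [V = C] and [e = 1]. Degree 4 uses the cyclic group of order 4 with [V] its
    subgroup of order 2 and [e = 2]. *)
Lemma word_profile n k (F : tc (wvar n k)) : 2 <= n -> 0 < k ->
  tc_invariant (@SnPow n k) F -> tc_computes (@perm_tuples n k) (@Word n k) F ->
  has_profile F n.
Proof.
case: n F => [|[|m]] // F _ k_gt0 invF compF.
have rot0 i : i %% m.+2 != 0 -> (rotation m ^+ i)%g (0%R : 'I_m.+2) != 0%R.
  by move=> hi; rewrite rotationX GRing.addr0 Zp_nat -val_eqE.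
have [n_ge|n_le] := leqP 5 m.+2; first exact: (Alt_word_bound (o := 0%R)).
pose C := <[rotation m]>%G.
have abC : abelian C := cycle_abelian _.
have cC : #|C| = m.+2 := order_rotation m.
have [p_pr|np] := boolP (prime m.+2).
  apply: (@abelian_word_bound _ k 0%R F k_gt0 erefl invF compF
    C C m.+2 1 (rotation m)) => //.
  - by move=> U sUC; rewrite expn1 (setIidPl sUC).
  - exact: cycle_id.
  by rewrite -[rotation m]expg1 rot0.
have m2 : m = 2 by case: m n_le np {rot0 C abC cC F invF compF} => [|[|[|]]].
subst m.
pose V := <[rotation 2 ^+ 2]>%G.
apply: (@abelian_word_bound _ k 0%R F k_gt0 erefl invF compF
  C V 2 2 (rotation 2 ^+ 2)%g) => //.
- by rewrite cycle_subG mem_cycle.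
- by rewrite /= -orderE orderXdiv ?order_rotation.
- apply: card_le_sq_involutions => //.
  + by rewrite /pgroup cC.
  + by move=> _ /cycleP[i ->]; rewrite -expgM mulnC expgM mem_cycle.
  + move=> _ /cycleP[i ->] /eqP; rewrite -expgM rotationX_eq1.
    rewrite -[4]/(2 * 2) dvdn_pmul2r // => /dvdnP[j ->].
    by rewrite mulnC expgM mem_cycle.
- exact: cycle_id.
exact: rot0.
Qed.

(** * From profiles to real exponents *)

Section RealBounds.
Local Open Scope R_scope.
Implicit Types (n k d : nat) (ts : seq nat).

Lemma INR_leq (a b : nat) : (a <= b)%N -> INR a <= INR b.
Proof. by move=> /leP; exact: le_INR. Qed.

Lemma INR_expn n i : INR (n ^ i)%N = INR n ^ i.
Proof. by elim: i => [|i IH]; rewrite ?expnS ?mult_INR ?IH. Qed.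

Lemma ln_le_sub1 (z : R) : 0 < z -> ln z <= z - 1.
Proof.
move=> z_gt0; have [e|ne] := Req_dec (ln z) 0.
  by have := exp_ln z z_gt0; rewrite e exp_0; lra.
by have := exp_ineq1 (ln z) ne; rewrite exp_ln //; lra.
Qed.

(* The tangent of [ln] at [q], with denominators cleared. *)
Lemma ln_tangent (q z : R) : 0 < q -> 0 < z -> q * ln z <= q * ln q + z - q.
Proof.
move=> q_gt0 z_gt0; have zq : 0 < z / q by exact: Rdiv_lt_0_compat.
have := ln_le_sub1 zq; rewrite /Rdiv ln_mult ?ln_Rinv //; last exact: Rinv_0_lt_compat.
move=> h; have : q * (ln z + - ln q) <= q * (z * / q - 1).
  by apply: Rmult_le_compat_l; lra.
have -> : q * (z * / q - 1) = z - q by field; lra.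
lra.
Qed.

Lemma ln_prod_tangent (q : R) ts : 0 < q ->
  q * ln (INR (\prod_(x <- ts) x.+1)) <=
    INR (size ts) * (q * ln q + 1 - q) + INR (sumn ts).
Proof.
move=> q_gt0; elim: ts => [|x ts IH].
  by rewrite big_nil /= ln_1; lra.
have x_gt0 : 0 < INR x.+1 by apply: lt_0_INR; lia.
have p_gt0 : 0 < INR (\prod_(y <- ts) y.+1).
  by apply: lt_0_INR; apply/ltP; rewrite prodn_gt0.
rewrite big_cons mult_INR ln_mult // Rmult_plus_distr_l.
have := ln_tangent q_gt0 x_gt0.
rewrite [size _]/= [sumn _]/= plus_INR !S_INR; lra.
Qed.

(** The tangent is taken at [q = k^(1/d)], the common value of [d] equal factors with product [k].
    Since [slack] is nonnegative, a list shorter than [d] only strengthens the estimate. *)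
Lemma profile_sum_ge_depth k d ts : (0 < k)%N -> (0 < d)%N ->
  (size ts <= d)%N -> (k <= \prod_(x <- ts) x.+1)%N ->
  INR d * (Rpower (INR k) (/ INR d) - INR 1) <= INR (sumn ts).
Proof.
move=> k_gt0 d_gt0 sz pr; set q := Rpower _ _.
have kR : 0 < INR k by apply: lt_0_INR; lia.
have dR : 0 < INR d by apply: lt_0_INR; lia.
have q_gt0 : 0 < q by exact: exp_pos.
have lnq : INR d * ln q = ln (INR k) by rewrite /q /Rpower ln_exp; field; lra.
have ln_le : ln (INR k) <= ln (INR (\prod_(x <- ts) x.+1)).
  have [lt|->] := INR_leq pr; last lra.
  by apply: Rlt_le; exact: ln_increasing.
have slack : 0 <= q * ln q + 1 - q.
  by have := ln_tangent q_gt0 Rlt_0_1; rewrite ln_1; lra.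
have : INR (size ts) * (q * ln q + 1 - q) <= INR d * (q * ln q + 1 - q).
  by apply: Rmult_le_compat_r => //; exact: INR_leq.
have : q * ln (INR k) <= q * ln (INR (\prod_(x <- ts) x.+1)).
  by apply: Rmult_le_compat_l => //; lra.
have := ln_prod_tangent ts q_gt0; rewrite -lnq /=; nra.
Qed.

Lemma profile_sum_ge_log k ts : (0 < k)%N -> (k <= \prod_(x <- ts) x.+1)%N ->
  ln (INR k) / ln (INR 2) <= INR (sumn ts).
Proof.
move=> k_gt0 pr; have ln2 : 0 < ln (INR 2).
  by rewrite /= -ln_1; apply: ln_increasing; lra.
(* Each factor satisfies [x.+1 <= 2 ^ x]. *)
have k_le : (k <= 2 ^ sumn ts)%N.
  apply: leq_trans pr _; elim: ts => [|x ts IH]; first by rewrite big_nil.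
  by rewrite big_cons [sumn _]/= expnD leq_mul // ltn_expl.
have kR : 0 < INR k by apply: lt_0_INR; lia.
apply: (Rmult_le_reg_r (ln (INR 2))) => //.
have -> : ln (INR k) / ln (INR 2) * ln (INR 2) = ln (INR k) by field; lra.
have p2 : 0 < INR 2 by rewrite /=; lra.
rewrite -ln_pow // -INR_expn.
have [lt|->] := INR_leq k_le; last lra.
by apply: Rlt_le; exact: ln_increasing.
Qed.

Lemma Rpower_le_expn n m s (x : R) : (2 <= n)%N -> x <= INR s ->
  (n ^ s <= m)%N -> Rpower (INR n) x <= INR m.
Proof.
move=> n_ge xs le_m; have nR : 1 <= INR n by have := INR_leq n_ge; rewrite /=; lra.
apply: Rle_trans (INR_leq le_m); rewrite INR_expn -Rpower_pow; last lra.
exact: Rle_Rpower.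
Qed.

End RealBounds.

(** Degree 1 is excluded because there a constant formula, of size 0, computes the word function
    while the bounds would equal 1. *)
Theorem theorem1p2 (n k d : nat) :
  2 <= n -> 1 <= k -> 1 <= d ->
  (forall F : tc (wvar n k),
     tc_wf F -> tc_invariant (@SnPow n k) F ->
     tc_computes (@perm_tuples n k) (@Word n k) F ->
     Rdefinitions.Rle
       (Rpower.Rpower (Raxioms.INR n)
          (Rdefinitions.Rdiv (Rpower.ln (Raxioms.INR k)) (Rpower.ln (Raxioms.INR 2))))
       (Raxioms.INR (tc_size F)))
  /\
  (forall F : tc (wvar n k),
     tc_wf F -> tc_depth F <= d -> tc_invariant (@SnPow n k) F ->
     tc_computes (@perm_tuples n k) (@Word n k) F ->
     Rdefinitions.Rle
       (Rpower.Rpower (Raxioms.INR n)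
          (Rdefinitions.Rmult (Raxioms.INR d)
             (Rdefinitions.Rminus
                (Rpower.Rpower (Raxioms.INR k) (Rdefinitions.Rinv (Raxioms.INR d)))
                (Raxioms.INR 1))))
       (Raxioms.INR (tc_size F))).
Proof.
move=> n_ge k_gt0 d_gt0; split=> [F _ invF compF|F _ dF invF compF].
  have [ts [_ pr le]] := word_profile n_ge k_gt0 invF compF.
  exact: Rpower_le_expn n_ge (profile_sum_ge_log k_gt0 pr) le.
have [ts [sz pr le]] := word_profile n_ge k_gt0 invF compF.
have bound := profile_sum_ge_depth k_gt0 d_gt0 (leq_trans sz dF) pr.
exact: Rpower_le_expn n_ge bound le.
Qed.
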